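(* Let $A$ be a ring and $M$ an $A$-bimodule with $ann_l(M)\subseteq ann_r(M)$ and $Zd_l(M)\subseteq zd_l(A)$. Then the trivial extension $A\propto M$ is a regular left fusible ring if and only if $A$ is a regular left fusible ring and $M=0$.
   Context: Rings are associative with identity, not necessarily commutative. For an $A$-bimodule $M$, $ann_l(M)=\{x\in A: xM=0\}$, $ann_r(M)=\{x\in A: Mx=0\}$, and $Zd_l(M)=\{a\in A: am=0\text{ for some }0\neq m\in M\}$. For a ring $A$, $zd_l(A)=\{a\in A: ax=0\text{ for some }0\neq x\in A\}$ is the set of left zero divisors of $A$. The trivial extension $A\propto M=\{(a,m): a\in A, m\in M\}$ is the ring with componentwise addition, multiplication $(a,m)(b,m')=(ab,am'+mb)$ and identity $(1,0)$. An element of a ring is regular if it is neither a left nor a right zero divisor. A nonzero element $a$ of a ring is left fusible if $a=z+r$ with $z$ a left zero divisor and $r$ not a left zero divisor. A ring is regular left fusible if for every nonzero element $a$ there is a regular element $s$ such that $sa$ is left fusible. *)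

(* Defs.v *)
From HB Require Import structures.
From mathcomp Require Import all_boot ssralg.

Set Implicit Arguments.
Unset Strict Implicit.
Unset Printing Implicit Defensive.

Import GRing.Theory.
Local Open Scope ring_scope.

(* Rings are [pzRingType]s: associative and unital, possibly noncommutative,
   possibly zero. The left action of a bimodule is the scaling [a *: m] of the
   underlying left module; the right action m a is written [rscale m a]. *)

HB.mixin Record Lmodule_isBimodule (A : pzRingType) M of GRing.Lmodule A M := {
  rscale : M -> A -> M;
  rscaleA : forall m a b, rscale (rscale m a) b = rscale m (a * b);
  rscale1 : forall m, rscale m 1 = m;
  rscaleDl : forall m n a, rscale (m + n) a = rscale m a + rscale n a;
  rscaleDr : forall m a b, rscale m (a + b) = rscale m a + rscale m b;
  scale_rscaleA : forall a m b, rscale (a *: m) b = a *: rscale m b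
}.

#[short(type="bimodType")]
HB.structure Definition Bimodule (A : pzRingType) :=
  {M of GRing.Lmodule A M & Lmodule_isBimodule A M}.

Section TrivialExtension.
Variables (A : pzRingType) (M : bimodType A).

(* A type of its own, so that multiplication is not the componentwise one that
   [prod] inherits. *)
Definition trivext : Type := (A * M)%type.

HB.instance Definition _ := GRing.Zmodule.copy trivext (A * M)%type.

Implicit Types x y z : trivext.

Definition trivext_one : trivext := (1, 0).

Definition trivext_mul x y : trivext :=
  (x.1 * y.1, x.1 *: y.2 + rscale x.2 y.1).

Fact rscale0r (m : M) : rscale m 0 = 0.
Proof. by apply: (addrI (rscale m 0)); rewrite -rscaleDr !addr0. Qed.

Fact rscale0l (a : A) : rscale (0 : M) a = 0.
Proof. by apply: (addrI (rscale 0 a)); rewrite -rscaleDl !addr0. Qed.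

Fact trivext_mulA : associative trivext_mul.
Proof.
move=> [a m] [b n] [c p]; congr pair => /=; first exact: mulrA.
by rewrite scalerDr scalerA rscaleDl scale_rscaleA rscaleA addrA.
Qed.

Fact trivext_mul1x : left_id trivext_one trivext_mul.
Proof.
by move=> [a m]; congr pair => /=; rewrite ?mul1r // scale1r rscale0l addr0.
Qed.

Fact trivext_mulx1 : right_id trivext_one trivext_mul.
Proof.
by move=> [a m]; congr pair => /=; rewrite ?mulr1 // scaler0 rscale1 add0r.
Qed.

Fact trivext_mulDl : left_distributive trivext_mul +%R.
Proof.
move=> [a m] [b n] [c p]; congr pair => /=; first exact: mulrDl.
by rewrite scalerDl rscaleDl addrACA.
Qed.

Fact trivext_mulDr : right_distributive trivext_mul +%R.
Proof.
move=> [a m] [b n] [c p]; congr pair => /=; first exact: mulrDr.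
by rewrite scalerDr rscaleDr addrACA.
Qed.

HB.instance Definition _ := GRing.Zmodule_isPzRing.Build trivext
  trivext_mulA trivext_mul1x trivext_mulx1 trivext_mulDl trivext_mulDr.

End TrivialExtension.

Arguments trivext : clear implicits.

Section ZeroDivisors.
Variable A : pzRingType.
Implicit Types a s x z r : A.

Definition zd_l a : Prop := exists2 x, x <> 0 & a * x = 0.

Definition zd_r a : Prop := exists2 x, x <> 0 & x * a = 0.

Definition regular a : Prop := ~ zd_l a /\ ~ zd_r a.

Definition left_fusible a : Prop :=
  a <> 0 /\ exists z r, [/\ a = z + r, zd_l z & ~ zd_l r].

End ZeroDivisors.

Definition regular_left_fusible (A : pzRingType) : Prop :=
  forall a : A, a <> 0 -> exists2 s : A, regular s & left_fusible (s * a).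

Section Annihilators.
Variables (A : pzRingType) (M : bimodType A).

Definition ann_l (x : A) : Prop := forall m : M, x *: m = 0.

Definition ann_r (x : A) : Prop := forall m : M, rscale m x = 0.

Definition Zd_l (a : A) : Prop := exists2 m : M, m <> 0 & a *: m = 0.

End Annihilators.

Arguments ann_l {A} M x.
Arguments ann_r {A} M x.
Arguments Zd_l {A} M a.

(* Main.v *)
Require Import Defs.
From HB Require Import structures.
From mathcomp Require Import all_boot ssralg.

Set Implicit Arguments.
Unset Strict Implicit.
Unset Printing Implicit Defensive.

Import GRing.Theory.
Local Open Scope ring_scope.

(** If [(0, m)] is the sum of [(z, p)] and [(r, q)], then [z = - r].  Suppose
    that [(r, q)] is not a left zero divisor.  Then [r] acts injectively on [M]
    ([Zd_l_zd_l_trivext]) and, by the hypothesis on annihilators, also on [A]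
    ([not_zd_l_trivext_fst]).  The same holds for [- r], so that [(z, p)] is not
    a left zero divisor either ([zd_l_trivextN]).  Hence no [(0, m)] is left
    fusible.  A left multiple of [(0, m)] again has this form, so that a regular
    left fusible trivial extension has no nonzero element [(0, m)], that is,
    [M = 0].

    When [M = 0], the first projection and the injection [a |-> (a, 0)] are
    mutually inverse ring morphisms between the trivial extension and [A], and
    regular left fusibility is invariant under isomorphism
    ([regular_left_fusible_iso]). *)

Section Isomorphism.
Variables (A B : pzRingType) (f : {rmorphism A -> B}) (g : B -> A).
Hypotheses (fK : cancel f g) (gK : cancel g f).

Lemma iso_neq0 x : x <> 0 <-> f x <> 0.
Proof. by split=> nx0 e; apply: nx0; [apply: (can_inj fK)|]; rewrite e rmorph0. Qed.

Lemma zd_l_iso a : zd_l a <-> zd_l (f a).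
Proof.
split=> [[x /iso_neq0 nx0 ax0]|[y ny0 ay0]].
  by exists (f x) => //; rewrite -rmorphM ax0 rmorph0.
exists (g y); first by apply/iso_neq0; rewrite gK.
by apply: (can_inj fK); rewrite rmorphM gK ay0 rmorph0.
Qed.

Lemma zd_r_iso a : zd_r a <-> zd_r (f a).
Proof.
split=> [[x /iso_neq0 nx0 xa0]|[y ny0 ya0]].
  by exists (f x) => //; rewrite -rmorphM xa0 rmorph0.
exists (g y); first by apply/iso_neq0; rewrite gK.
by apply: (can_inj fK); rewrite rmorphM gK ya0 rmorph0.
Qed.

Lemma regular_iso a : regular a <-> regular (f a).
Proof.
by split=> -[nzdl nzdr]; split;
  [move/zd_l_iso | move/zd_r_iso | move/zd_l_iso | move/zd_r_iso].
Qed.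

Lemma left_fusible_iso a : left_fusible a -> left_fusible (f a).
Proof.
move=> [/iso_neq0 na0 [z [r [aE zdz nzdr]]]]; split=> //.
exists (f z), (f r); split; first by rewrite aE rmorphD.
  exact/zd_l_iso.
by move/zd_l_iso.
Qed.

Lemma regular_left_fusible_iso :
  regular_left_fusible A -> regular_left_fusible B.
Proof.
move=> rlfA b nb0.
have /rlfA[s reg_s fus_s] : g b <> 0 by apply/iso_neq0; rewrite gK.
exists (f s); first exact/regular_iso.
by rewrite -[b]gK -rmorphM; apply: left_fusible_iso.
Qed.

End Isomorphism.

Section TrivextMorphisms.
Variables (A : pzRingType) (M : bimodType A).

Definition trivext_fst (x : trivext A M) : A := x.1.

Definition trivext_in (a : A) : trivext A M := (a, 0).

Fact trivext_fst_zmod_morphism : zmod_morphism trivext_fst.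
Proof. by []. Qed.

HB.instance Definition _ :=
  GRing.isZmodMorphism.Build (trivext A M) A trivext_fst
    trivext_fst_zmod_morphism.

Fact trivext_fst_monoid_morphism : monoid_morphism trivext_fst.
Proof. by []. Qed.

HB.instance Definition _ :=
  GRing.isMonoidMorphism.Build (trivext A M) A trivext_fst
    trivext_fst_monoid_morphism.

Fact trivext_in_zmod_morphism : zmod_morphism trivext_in.
Proof. by move=> a b; congr pair; rewrite subr0. Qed.

HB.instance Definition _ :=
  GRing.isZmodMorphism.Build A (trivext A M) trivext_in
    trivext_in_zmod_morphism.

Fact trivext_in_monoid_morphism : monoid_morphism trivext_in.
Proof.
by split=> // a b; congr pair; rewrite /= scaler0 rscale0l addr0.
Qed.

HB.instance Definition _ :=
  GRing.isMonoidMorphism.Build A (trivext A M) trivext_in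
    trivext_in_monoid_morphism.

Lemma trivext_inK : cancel trivext_in trivext_fst.
Proof. by []. Qed.

Lemma trivext_fstK : (forall m : M, m = 0) -> cancel trivext_fst trivext_in.
Proof. by move=> M0 [a m]; rewrite (M0 m). Qed.

End TrivextMorphisms.

Section TrivextZeroDivisors.
Variables (A : pzRingType) (M : bimodType A).
Implicit Types (a r x : A) (m p q : M).

Lemma trivext_mulE a m b p :
  ((a, m) : trivext A M) * (b, p) = (a * b, a *: p + rscale m b).
Proof. by []. Qed.

Lemma Zd_l_zd_l_trivext r q : Zd_l M r -> zd_l ((r, q) : trivext A M).
Proof.
move=> [m nm0 rm0]; exists (0, m); first by case.
by rewrite trivext_mulE mulr0 rm0 rscale0r addr0.
Qed.

(** Let [r x = 0] with [x] nonzero.  Either [x m] is nonzero for some [m], and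
    then [(r, q)] annihilates [(0, x m)]; or [x M = 0], so that [M x = 0] and
    [(r, q)] annihilates [(x, 0)]. *)
Lemma not_zd_l_trivext_fst r q : (forall x, ann_l M x -> ann_r M x) ->
  ~ zd_l ((r, q) : trivext A M) -> ~ zd_l r.
Proof.
move=> hann nzd [x nx0 rx0]; apply: (nzd).
have xM0 : ann_l M x.
  move=> m; case: (x *: m =P 0) => // nxm0.
  case: nzd; apply: Zd_l_zd_l_trivext; exists (x *: m) => //.
  by rewrite scalerA rx0 scale0r.
exists (x, 0); first by case.
by rewrite trivext_mulE rx0 scaler0 (hann _ xM0) addr0.
Qed.

Lemma zd_l_trivextN r p :
  zd_l ((- r, p) : trivext A M) -> zd_l r \/ Zd_l M r.
Proof.
move=> [[x m] nxm0]; rewrite trivext_mulE mulNr scaleNr.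
case=> /eqP; rewrite oppr_eq0 => /eqP rx0 e.
have [x0|/eqP nx0] := eqVneq x 0; last by left; exists x.
right; exists m; first by move=> m0; apply: nxm0; rewrite x0 m0.
by move: e; rewrite x0 rscale0r addr0 => /eqP; rewrite oppr_eq0 => /eqP.
Qed.

Lemma not_left_fusible_trivext_snd m :
  (forall x, ann_l M x -> ann_r M x) -> ~ left_fusible ((0, m) : trivext A M).
Proof.
move=> hann [_ [[z p] [[r q] [[zr _] zdz nzdr]]]].
have zE : z = - r by apply/eqP; rewrite -addr_eq0; apply/eqP.
move: zdz; rewrite zE => /zd_l_trivextN [|/Zd_l_zd_l_trivext//].
exact: not_zd_l_trivext_fst nzdr.
Qed.

End TrivextZeroDivisors.

Theorem corollary5 (A : pzRingType) (M : bimodType A)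
  (hann : forall x : A, ann_l M x -> ann_r M x)
  (hZd : forall a : A, Zd_l M a -> zd_l a) :
  regular_left_fusible (trivext A M) <->
  regular_left_fusible A /\ (forall m : M, m = 0).
Proof.
split=> [rlf | [rlfA M0]]; last first.
  exact: (regular_left_fusible_iso (@trivext_inK A M) (trivext_fstK M0)).
have M0 (m : M) : m = 0.
  case: (m =P 0) => // nm0.
  have [|[s n] _] := rlf (0, m); first by case.
  by rewrite trivext_mulE mulr0 => /not_left_fusible_trivext_snd; case.
split=> //.
exact: (regular_left_fusible_iso (trivext_fstK M0) (@trivext_inK A M)) rlf.
Qed.
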